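(* Let $K$ be a field with $\mathrm{char}(K)\neq 2$ (characteristic $3$ allowed). Let $a_1,a_2,a_3\in K$ be such that $a_1^2,a_2^2,a_3^2$ are distinct, consider the elliptic curve $E: y^2=(x+a_1^2)(x+a_2^2)(x+a_3^2)$ over $K$, and let $P=(0,a_1a_2a_3)\in E(K)$. Then: (i) $P$ is divisible by $2$ in $E(K)$; more precisely, the four points $Q\in E(K)$ with $2Q=P$ are $(a_2a_3-a_1a_2-a_3a_1,\ (a_1-a_2)(a_2+a_3)(a_3-a_1))$, $(a_3a_1-a_1a_2-a_2a_3,\ (a_1-a_2)(a_2-a_3)(a_3+a_1))$, $(a_1a_2-a_2a_3-a_3a_1,\ (a_1+a_2)(a_2-a_3)(a_3-a_1))$, $(a_1a_2+a_2a_3+a_3a_1,\ (a_1+a_2)(a_2+a_3)(a_3+a_1))$. (ii) $P$ has order $3$ if and only if none of the $a_i$ vanishes (so that $\pm a_1,\pm a_2,\pm a_3$ are six distinct elements of $K$) and one of the following four equalities holds: $a_2a_3=a_1a_2+a_3a_1$, $a_3a_1=a_1a_2+a_2a_3$, $a_1a_2=a_2a_3+a_3a_1$, $a_1a_2+a_2a_3+a_3a_1=0$. (iii) If $P$ has order $3$, then one of the four points $Q$ from (i) coincides with $-P$ and has order $3$, while the other three have order $6$; moreover, $E(K)$ contains a subgroup isomorphic to $\mathbb{Z}/6\mathbb{Z}\oplus\mathbb{Z}/2\mathbb{Z}$. *)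

(* Defs.v *)
From HB Require Import structures.
From mathcomp Require Import all_boot all_order all_algebra all_field.
From mathcomp Require Import ring.

Set Implicit Arguments.
Unset Strict Implicit.
Unset Printing Implicit Defensive.

Import GRing.Theory.
Local Open Scope ring_scope.

(* The elliptic curve y^2 = f(x) over a field of characteristic other than 2;
   such a curve is smooth exactly when the cubic f is separable. *)
Record ecurve (K : fieldType) := ECurve {
  cubic : {poly K};
  ecurve_char : 2%N \notin [pchar K];
  cubic_monic : cubic \is monic;
  size_cubic : size cubic = 4%N;
  cubic_separable : separable_poly cubic
}.

Section GroupLaw.
Variables (K : fieldType) (E : ecurve K).
Local Notation f := (cubic E).

(* None is the point at infinity, Some (x, y) an affine point. *)
Definition on_curve (p : option (K * K)) : bool :=
  if p is Some (x, y) then y ^+ 2 == f.[x] else true.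

Record point := Point { pval :> option (K * K); pvalP : on_curve pval }.

HB.instance Definition _ := [isSub for pval].
HB.instance Definition _ := [Equality of point by <:].

Definition affine_point (x y : K) (xyP : y ^+ 2 = f.[x]) : point :=
  @Point (Some (x, y)) (introT eqP xyP).

Definition opp_raw (p : option (K * K)) : option (K * K) :=
  if p is Some (x, y) then Some (x, - y) else None.

(* Slope of the line through two affine points that are not opposite
   (the tangent line when they coincide). *)
Definition slope (x1 y1 x2 y2 : K) : K :=
  if x1 == x2 then f^`().[x1] / (2 * y1) else (y2 - y1) / (x2 - x1).

Definition add_raw (p q : option (K * K)) : option (K * K) :=
  match p, q with
  | None, _ => q
  | _, None => p
  | Some (x1, y1), Some (x2, y2) =>
      if (x1 == x2) && (y1 == - y2) then None else
      let l := slope x1 y1 x2 y2 in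
      let x3 := l ^+ 2 - f`_2 - x1 - x2 in
      Some (x3, l * (x1 - x3) - y1)
  end.

Lemma horner_cubic x : f.[x] = x ^+ 3 + f`_2 * x ^+ 2 + f`_1 * x + f`_0.
Proof.
have f3 : f`_3 = 1.
  by have /monicP := cubic_monic E; rewrite lead_coefE size_cubic.
rewrite horner_coef size_cubic !big_ord_recl big_ord0 /= f3.
by rewrite /bump /= ?addn0 ?add1n ?addn1; ring.
Qed.

Lemma horner_deriv_cubic x : f^`().[x] = 3 * x ^+ 2 + 2 * f`_2 * x + f`_1.
Proof.
have f3 : f`_3 = 1.
  by have /monicP := cubic_monic E; rewrite lead_coefE size_cubic.
have sz : (size f^`() <= 3)%N by rewrite -ltnS -(size_cubic E) lt_size_deriv //
  -size_poly_gt0 size_cubic.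
rewrite (horner_coef_wide _ sz) !big_ord_recl big_ord0 /= !coef_deriv /= f3.
by rewrite /bump /=; ring.
Qed.

Lemma on_curve_opp p : on_curve p -> on_curve (opp_raw p).
Proof. by case: p => [[x y]|] //=; rewrite sqrrN. Qed.

Lemma on_curve_add p q : on_curve p -> on_curve q -> on_curve (add_raw p q).
Proof.
case: p q => [[x1 y1]|] [[x2 y2]|] //= /eqP e1 /eqP e2.
case: ifPn => // npq /=; set l := slope x1 y1 x2 y2.
rewrite horner_cubic in e1; rewrite horner_cubic in e2.
have two0 : (2 : K) != 0 by have := ecurve_char E; rewrite inE.
have ec : f`_0 = y1 ^+ 2 - x1 ^+ 3 - f`_2 * x1 ^+ 2 - f`_1 * x1.
  by rewrite e1; ring.
have eb : f`_1 = l * (2 * y1 + l * (x2 - x1))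
    - x1 ^+ 2 - x1 * x2 - x2 ^+ 2 - f`_2 * (x1 + x2).
  rewrite /l /slope; case: (eqVneq x1 x2) npq => [ex|nx] /= npq.
    move: npq; rewrite -ex in e2 *.
    have /eqP : (y1 - y2) * (y1 + y2) = 0 by rewrite -subr_sqr e1 e2 subrr.
    rewrite mulf_eq0 subr_eq0 addr_eq0 => /orP[/eqP <-|->//] npq.
    have y0 : y1 != 0.
      by apply: contraNneq npq => ->; rewrite oppr0.
    by rewrite horner_deriv_cubic; field; rewrite y0 two0.
  have dx : x2 - x1 != 0 by rewrite subr_eq0 eq_sym.
  have : (y2 - y1) * (y2 + y1) = (x2 - x1) *
     (x1 ^+ 2 + x1 * x2 + x2 ^+ 2 + f`_2 * (x1 + x2) + f`_1).
    by rewrite -subr_sqr e1 e2; ring.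
  move=> h; apply: (mulfI dx).
  transitivity ((y2 - y1) * (y2 + y1) - (x2 - x1) *
     (x1 ^+ 2 + x1 * x2 + x2 ^+ 2 + f`_2 * (x1 + x2))); last by field.
  by rewrite h; ring.
by rewrite horner_cubic ec eb; apply/eqP; ring.
Qed.

Definition zerop : point := @Point None isT.
Definition oppp (P : point) : point := Point (on_curve_opp (pvalP P)).
Definition addp (P Q : point) : point := Point (on_curve_add (pvalP P) (pvalP Q)).
Definition mulp (n : nat) (P : point) : point := iter n (addp P) zerop.

Definition has_order (P : point) (n : nat) : Prop :=
  [/\ (0 < n)%N, mulp n P = zerop
    & forall m : nat, (0 < m < n)%N -> mulp m P <> zerop].

End GroupLaw.

Arguments zerop {K E}.

Section SquareRootsCurve.
Variables (K : fieldType) (a1 a2 a3 : K).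

Definition squares_cubic : {poly K} :=
  ('X + (a1 ^+ 2)%:P) * ('X + (a2 ^+ 2)%:P) * ('X + (a3 ^+ 2)%:P).

Lemma squares_cubicE :
  squares_cubic =
    \prod_(r <- [:: - a1 ^+ 2; - a2 ^+ 2; - a3 ^+ 2]) ('X - r%:P).
Proof. by rewrite !big_cons big_nil mulr1 !polyCN !opprK mulrA. Qed.

Lemma squares_cubic_monic : squares_cubic \is monic.
Proof. by rewrite squares_cubicE monic_prod_XsubC. Qed.

Lemma size_squares_cubic : size squares_cubic = 4%N.
Proof. by rewrite squares_cubicE size_prod_XsubC. Qed.

Hypothesis charK : 2%N \notin [pchar K].
Hypothesis uniq_sqr : uniq [:: a1 ^+ 2; a2 ^+ 2; a3 ^+ 2].

Lemma squares_cubic_separable : separable_poly squares_cubic.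
Proof.
rewrite squares_cubicE separable_prod_XsubC.
by rewrite (map_inj_uniq (@oppr_inj K) [:: a1 ^+ 2; a2 ^+ 2; a3 ^+ 2]).
Qed.

Definition squares_curve : ecurve K :=
  ECurve charK squares_cubic_monic size_squares_cubic squares_cubic_separable.

Lemma horner_squares_cubic (x : K) : squares_cubic.[x] =
  (x + a1 ^+ 2) * (x + a2 ^+ 2) * (x + a3 ^+ 2).
Proof. by rewrite !hornerM !hornerD !hornerC !hornerX. Qed.

Fact base_point_on_curve :
  (a1 * a2 * a3) ^+ 2 = squares_cubic.[0].
Proof. by rewrite horner_squares_cubic; ring. Qed.

Definition base_point : point squares_curve :=
  @affine_point K squares_curve
    0 (a1 * a2 * a3) base_point_on_curve.

Fact half1_on_curve :
  ((a1 - a2) * (a2 + a3) * (a3 - a1)) ^+ 2 = squares_cubic.[a2 * a3 - a1 * a2 - a3 * a1].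
Proof. by rewrite horner_squares_cubic; ring. Qed.

Definition half1 : point squares_curve :=
  @affine_point K squares_curve
    (a2 * a3 - a1 * a2 - a3 * a1) ((a1 - a2) * (a2 + a3) * (a3 - a1)) half1_on_curve.

Fact half2_on_curve :
  ((a1 - a2) * (a2 - a3) * (a3 + a1)) ^+ 2 = squares_cubic.[a3 * a1 - a1 * a2 - a2 * a3].
Proof. by rewrite horner_squares_cubic; ring. Qed.

Definition half2 : point squares_curve :=
  @affine_point K squares_curve
    (a3 * a1 - a1 * a2 - a2 * a3) ((a1 - a2) * (a2 - a3) * (a3 + a1)) half2_on_curve.

Fact half3_on_curve :
  ((a1 + a2) * (a2 - a3) * (a3 - a1)) ^+ 2 = squares_cubic.[a1 * a2 - a2 * a3 - a3 * a1].
Proof. by rewrite horner_squares_cubic; ring. Qed.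

Definition half3 : point squares_curve :=
  @affine_point K squares_curve
    (a1 * a2 - a2 * a3 - a3 * a1) ((a1 + a2) * (a2 - a3) * (a3 - a1)) half3_on_curve.

Fact half4_on_curve :
  ((a1 + a2) * (a2 + a3) * (a3 + a1)) ^+ 2 = squares_cubic.[a1 * a2 + a2 * a3 + a3 * a1].
Proof. by rewrite horner_squares_cubic; ring. Qed.

Definition half4 : point squares_curve :=
  @affine_point K squares_curve
    (a1 * a2 + a2 * a3 + a3 * a1) ((a1 + a2) * (a2 + a3) * (a3 + a1)) half4_on_curve.

Definition halves : seq (point squares_curve) :=
  [:: half1; half2; half3; half4].

End SquareRootsCurve.

(* Main.v *)
Require Import Defs.
From mathcomp Require Import all_boot all_order all_algebra all_field.
From mathcomp Require Import ring.
Set Implicit Arguments.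
Unset Strict Implicit.
Unset Printing Implicit Defensive.
Import GRing.Theory.
Local Open Scope ring_scope.

(* If 2Q = P, the slope l of the tangent at Q satisfies
   (l^2 - s1)^2 - 4 s2 - 8 a1 a2 a3 l = 0, with s1 and s2 the elementary
   symmetric functions of the squares of the a_i.  This quartic splits, with
   roots a1 + a2 + a3, a1 - a2 - a3, - a1 + a2 - a3 and - a1 - a2 + a3, and each
   root determines Q.  The point P has order 3 iff 2(-P) = P, i.e. iff -P is one
   of the four halves, which amounts to one of them having abscissa 0.  Changing
   the signs of two of the a_i preserves E and P and permutes the halves, so one
   may then assume a1 a2 + a2 a3 + a3 a1 = 0.  Associativity of the group law is
   never used: all sums among the twelve points O, T_i, P, -P, P + T_i, -P + T_i,
   where T_i = (- a_i^2, 0), come from chords whose slopes are explicit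
   polynomials in the a_i. *)

(** * Identities of chord-and-tangent addition *)

Section GroupLaw.
Variables (K : fieldType) (E : ecurve K).
Implicit Types (p q r : point E) (x y l : K).

Lemma two_neq0 : (2 : K) != 0.
Proof. by have := ecurve_char E; rewrite inE. Qed.

Lemma add0p p : addp zerop p = p.
Proof. exact: val_inj. Qed.

Lemma addp0 p : addp p zerop = p.
Proof. by apply: val_inj => /=; case: (pval p) => [[]|]. Qed.

Lemma oppp0 : oppp (zerop : point E) = zerop.
Proof. exact: val_inj. Qed.

Lemma opppK p : oppp (oppp p) = p.
Proof. by apply: val_inj => /=; case: (pval p) => [[x y]|] //=; rewrite opprK. Qed.

Lemma addpN p : addp p (oppp p) = zerop.
Proof.
apply: val_inj => /=; case: (pval p) => [[x y]|] //=.
by rewrite opprK !eqxx.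
Qed.

Lemma addp_eq0 p q : addp p q = zerop -> q = oppp p.
Proof.
move=> /(congr1 val) /= h; apply: val_inj => /=; move: h.
case: (pval p) (pval q) => [[x y]|] [[z t]|] //=.
by case: ifP => // /andP[/eqP -> /eqP ->]; rewrite opprK.
Qed.

(** For equal abscissas [slope] reads only the first ordinate; symmetry then comes from the curve
    equation, which leaves equal or opposite ordinates, and opposite ones are excluded. *)
Lemma addpC p q : addp p q = addp q p.
Proof.
apply: val_inj => /=.
move: (pvalP p) (pvalP q).
case: (pval p) (pval q) => [[x y]|] [[z t]|] //= /eqP e1 /eqP e2.
rewrite (eq_sym x z) -eqr_oppLR [- y == t]eq_sym; case: ifPn => // n.
congr (Some _); rewrite /slope (eq_sym x z).
case: eqVneq n => [exz|nx] /= n.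
  have /eqP : (y - t) * (y + t) = 0.
    by rewrite -subr_sqr e1 e2 exz subrr.
  rewrite mulf_eq0 subr_eq0 addr_eq0 => /orP[/eqP ->|/eqP h]; first by rewrite exz.
  by rewrite h opprK eqxx in n.
have d1 : z - x != 0 by rewrite subr_eq0.
have d2 : x - z != 0 by rewrite subr_eq0 eq_sym.
by congr pair; field; rewrite d1 d2.
Qed.

Lemma opppD p q : oppp (addp p q) = addp (oppp p) (oppp q).
Proof.
apply: val_inj => /=.
case: (pval p) (pval q) => [[x y]|] [[z t]|] //=.
rewrite eqr_opp; case: ifP => //= _.
have -> : slope E x (- y) z (- t) = - slope E x y z t.
  by rewrite /slope; case: ifP => _; rewrite ?mulrN ?invrN ?mulrN // -opprD mulNr.
by rewrite sqrrN; congr (Some (_, _)); ring.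
Qed.

(** The slope enters through a division-free equation, so that for explicit points each premise is a
    polynomial identity or a nonvanishing. *)
Lemma addp_chord p q r x1 y1 x2 y2 x3 y3 l :
    pval p = Some (x1, y1) -> pval q = Some (x2, y2) -> pval r = Some (x3, y3) ->
    x2 - x1 != 0 -> y2 - y1 = l * (x2 - x1) ->
    x3 = l ^+ 2 - (cubic E)`_2 - x1 - x2 -> y3 = l * (x1 - x3) - y1 ->
  addp p q = r.
Proof.
move=> ep eq er nx el ex ey; rewrite {}ey {}ex in er.
apply: val_inj; rewrite /= ep eq er /= /slope [x1 == x2]eq_sym -subr_eq0.
by rewrite (negbTE nx) /= el mulfK.
Qed.

Lemma addp_tangent p r x1 y1 x3 y3 l :
    pval p = Some (x1, y1) -> pval r = Some (x3, y3) ->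
    y1 != 0 -> (cubic E)^`().[x1] = l * (2 * y1) ->
    x3 = l ^+ 2 - (cubic E)`_2 - x1 - x1 -> y3 = l * (x1 - x3) - y1 ->
  addp p p = r.
Proof.
move=> ep er ny el ex ey; rewrite {}ey {}ex in er.
have y20 : 2 * y1 != 0 by rewrite mulf_neq0 ?two_neq0.
apply: val_inj; rewrite /= ep er /= /slope !eqxx el mulfK //.
by rewrite -addr_eq0 -mulr2n -mulr_natl (negbTE y20).
Qed.

End GroupLaw.

(** * Explicit chords and tangents through torsion points and halves *)

Section Roots.
Variables (K : fieldType) (E : ecurve K).

(** The curve stays fixed while the triple varies: [squares_curve] of a permuted or sign-changed
    triple would be another term, with another type of points. *)
Definition square_roots (a b c : K) : Prop :=
  cubic E = squares_cubic a b c /\ uniq [:: a ^+ 2; b ^+ 2; c ^+ 2].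

Lemma square_roots_rot a b c : square_roots a b c -> square_roots b c a.
Proof.
case=> e u; split; first by rewrite e /squares_cubic; ring.
by rewrite -(rot_uniq 2).
Qed.

Lemma square_roots_signs a b c : square_roots a b c ->
  [/\ square_roots a (- b) (- c), square_roots (- a) b (- c)
    & square_roots (- a) (- b) c].
Proof. by rewrite /square_roots /squares_cubic !sqrrN. Qed.

(** These are the factors of the differences of squares; the ordinates of the halves and many
    abscissa differences below are products of them. *)
Lemma square_roots_neq a b c : square_roots a b c ->
  [/\ a - b != 0, a + b != 0 & b - c != 0] /\
  [/\ b + c != 0, c - a != 0 & c + a != 0].
Proof.
case=> _ /=; rewrite !inE !negb_or andbT => /andP[/andP[ab ac] bc].
move: ab ac bc; rewrite -!(subr_eq0 (_ ^+ 2)) !subr_sqr !mulf_eq0 !negb_or.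
move=> /andP[-> ->] /andP[ac ca] /andP[-> ->].
by split=> //; rewrite ?[c + a]addrC // -opprB oppr_eq0.
Qed.

Lemma square_roots_coef a b c : square_roots a b c ->
  (cubic E)`_2 = a ^+ 2 + b ^+ 2 + c ^+ 2 /\
  (cubic E)`_1 = (a * b) ^+ 2 + (b * c) ^+ 2 + (c * a) ^+ 2.
Proof.
case=> -> _; rewrite /squares_cubic.
have -> : ('X + (a ^+ 2)%:P) * ('X + (b ^+ 2)%:P) * ('X + (c ^+ 2)%:P) =
    'X^3 + (a ^+ 2 + b ^+ 2 + c ^+ 2)%:P * 'X^2
    + ((a * b) ^+ 2 + (b * c) ^+ 2 + (c * a) ^+ 2)%:P * 'X
    + ((a * b * c) ^+ 2)%:P.
  by rewrite !exprMn !polyCD !polyCM; ring.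
by rewrite !coefD !coefCM !coefXn !coefX !coefC /=; split; ring.
Qed.

Lemma square_roots_deriv a b c x : square_roots a b c ->
  (cubic E)^`().[x] = (x + a ^+ 2) * (x + b ^+ 2) + (x + b ^+ 2) * (x + c ^+ 2)
    + (x + c ^+ 2) * (x + a ^+ 2).
Proof.
by case/square_roots_coef=> e2 e1; rewrite horner_deriv_cubic e2 e1; ring.
Qed.

Definition is_base a b c (p : point E) := pval p = Some (0, a * b * c).
Definition is_torsion a (t : point E) := pval t = Some (- a ^+ 2, 0).
(* The four halves of (0, a b c) arise by changing the signs of two of the
   roots; a cyclic permutation has the same effect as such a change. *)
Definition is_half a b c (h : point E) :=
  pval h = Some (b * c - a * b - c * a, (a - b) * (b + c) * (c - a)).

Variables (a b c : K) (p h h1 h2 h3 h4 t t1 t2 t3 : point E).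
Hypothesis abc : square_roots a b c.

Lemma torsion_opp : is_torsion a t -> oppp t = t.
Proof. by move=> et; apply: val_inj; rewrite /= et /= oppr0. Qed.

(** The chord is the axis y = 0, which meets the curve in the three points of order 2. *)
Lemma torsion_add : is_torsion a t1 -> is_torsion b t2 -> is_torsion c t3 ->
  addp t1 t2 = t3.
Proof.
move=> e1 e2 e3; have [s1 _] := square_roots_coef abc.
have [[ab ab' _] _] := square_roots_neq abc.
apply: (addp_chord (l := 0) e1 e2 e3); rewrite ?s1; try ring.
by rewrite [X in X != 0](_ : _ = (a - b) * (a + b)) ?mulf_neq0 //; ring.
Qed.

(** The tangent at the half has slope a - b - c, a value that later identifies the half. *)
Lemma addp_half_half : is_half a b c h -> is_base a b c p -> addp h h = p.
Proof.
move=> eh ep; have [s1 _] := square_roots_coef abc.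
have [[ab ab' bc] [bc' ca ca']] := square_roots_neq abc.
apply: (addp_tangent (l := a - b - c) eh ep); rewrite ?s1; try ring.
  by rewrite !mulf_neq0.
by rewrite (square_roots_deriv _ abc); ring.
Qed.

(** Halves of one point differ by 2-torsion: adding the torsion point of one root flips the signs of
    the other two. The next two lemmas write this flip as a rotation. *)
Lemma half_add_torsion1 :
  is_half a b c h1 -> is_torsion a t1 -> is_half a (- b) (- c) h4 ->
  addp h1 t1 = h4.
Proof.
move=> eh et e4; have [s1 _] := square_roots_coef abc.
have [[ab ab' bc] [bc' ca ca']] := square_roots_neq abc.
apply: (addp_chord (l := - (b + c)) eh et e4); rewrite ?s1; try ring.
by rewrite [X in X != 0](_ : _ = (a - b) * (c - a)) ?mulf_neq0 //; ring.
Qed.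

Lemma half_add_torsion2 :
  is_half a b c h1 -> is_torsion b t2 -> is_half c a b h3 -> addp h1 t2 = h3.
Proof.
move=> eh et e3; have [s1 _] := square_roots_coef abc.
have [[ab ab' bc] [bc' ca ca']] := square_roots_neq abc.
apply: (addp_chord (l := a - c) eh et e3); rewrite ?s1; try ring.
by rewrite [X in X != 0](_ : _ = (a - b) * (b + c)) ?mulf_neq0 //; ring.
Qed.

Lemma half_add_torsion3 :
  is_half a b c h1 -> is_torsion c t3 -> is_half b c a h2 -> addp h1 t3 = h2.
Proof.
move=> eh et e2; have [s1 _] := square_roots_coef abc.
have [[ab ab' bc] [bc' ca ca']] := square_roots_neq abc.
apply: (addp_chord (l := a - b) eh et e2); rewrite ?s1; try ring.
by rewrite [X in X != 0](_ : _ = - (b + c) * (c - a)) ?mulf_neq0 ?oppr_eq0 //; ring.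
Qed.

(** The abscissas differ by 2 c (a - b), hence the condition on c. *)
Lemma half_sub_half : c != 0 ->
  is_half a b c h1 -> is_half b c a h2 -> is_torsion c t3 ->
  addp h1 (oppp h2) = t3.
Proof.
move=> c0 e1 e2 et; have [s1 _] := square_roots_coef abc.
have [[ab ab' bc] [bc' ca ca']] := square_roots_neq abc.
have eN2 : pval (oppp h2) = Some (c * a - b * c - a * b,
    - ((b - c) * (c + a) * (a - b))) by rewrite /= e2.
apply: (addp_chord (l := a - b) e1 eN2 et); rewrite ?s1; try ring.
by rewrite [X in X != 0](_ : _ = 2 * c * (a - b)) ?mulf_neq0 ?two_neq0 //; ring.
Qed.

(** The case in which -P is the half with signs (a, -b, -c). The equation is solved for a monomial
    so that [ring:] can rewrite with it. *)
Hypothesis e2_0 : a * b = - (b * c + c * a).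

(** The three halves other than -P are collinear, on a line of slope -(a + b + c). *)
Lemma half_add_half : c != 0 ->
  is_half a b c h1 -> is_half b c a h2 -> is_half c a b h3 ->
  addp h1 h2 = oppp h3.
Proof.
move=> c0 e1 e2 e3; have [s1 _] := square_roots_coef abc.
have [[ab ab' bc] [bc' ca ca']] := square_roots_neq abc.
have eN3 : pval (oppp h3) = Some (a * b - c * a - b * c,
    - ((c - a) * (a + b) * (b - c))) by rewrite /= e3.
apply: (addp_chord (l := - (a + b + c)) e1 e2 eN3); rewrite ?s1; try ring: e2_0.
by rewrite [X in X != 0](_ : _ = 2 * c * (a - b)) ?mulf_neq0 ?two_neq0 //; ring.
Qed.

(** A rearrangement of 2h = P: the tangent at h passes through -P, so it is also this chord. *)
Lemma half_sub_base : a * b * c != 0 ->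
  is_half a b c h -> is_base a b c p -> addp h (oppp p) = oppp h.
Proof.
move=> abc0 eh ep; have [s1 _] := square_roots_coef abc.
have [[ab ab' bc] [bc' ca ca']] := square_roots_neq abc.
have eNh : pval (oppp h) = Some (b * c - a * b - c * a,
    - ((a - b) * (b + c) * (c - a))) by rewrite /= eh.
have eNp : pval (oppp p) = Some (0, - (a * b * c)) by rewrite /= ep.
apply: (addp_chord (l := a - b - c) eh eNp eNh); rewrite ?s1; try ring: e2_0.
rewrite [X in X != 0](_ : _ = - (2 * (b * c))); last by ring: e2_0.
move: abc0; rewrite !mulf_eq0 !negb_or => /andP[/andP[_ b0] c0].
by rewrite oppr_eq0 !mulf_neq0 ?two_neq0.
Qed.

(** The points h, P and T lie on one line, the chord already met in [half_add_torsion1]. *)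
Lemma half_add_base : a * b * c != 0 ->
  is_half a b c h -> is_base a b c p -> is_torsion a t -> addp h p = t.
Proof.
move=> abc0 eh ep et; have [s1 _] := square_roots_coef abc.
apply: (addp_chord (l := - (b + c)) eh ep et); rewrite ?s1; try ring: e2_0.
rewrite [X in X != 0](_ : _ = - (2 * (b * c))); last by ring: e2_0.
move: abc0; rewrite !mulf_eq0 !negb_or => /andP[/andP[_ b0] c0].
by rewrite oppr_eq0 !mulf_neq0 ?two_neq0.
Qed.

End Roots.

(** * Criteria for orders 3 and 6 *)

Section Orders.
Variables (K : fieldType) (E : ecurve K).
Implicit Types p q h t : point E.

Lemma mulp2 p : mulp 2 p = addp p p.
Proof. by rewrite /mulp /= addp0. Qed.

Lemma has_order3P p : has_order p 3 <-> p <> zerop /\ addp p p = oppp p.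
Proof.
rewrite /has_order /mulp /=; split=> [[_ p3 np]|[np pp]].
  split; first by have := np 1%N isT; rewrite /= addp0.
  by apply: addp_eq0; rewrite addp0 in p3.
split=> //; first by rewrite addp0 pp addpN.
case=> [|[|[|//]]] //= _; rewrite addp0 // pp => p0.
by apply: np; rewrite -[p]opppK p0 oppp0.
Qed.

(** The premises make the successive multiples of h equal to h, p, t, -p, -h, O. *)
Lemma has_order6 h p t : h <> zerop -> p <> zerop -> t <> zerop ->
    addp h h = p -> addp h p = t -> addp h t = oppp p ->
    addp h (oppp p) = oppp h ->
  has_order h 6.
Proof.
have N0 q : q <> zerop -> oppp q <> zerop.
  by move=> q0 e; apply: q0; rewrite -[q]opppK e oppp0.
move=> h0 p0 t0 hh hp ht hNp; split=> //.
  by rewrite /mulp /= addp0 hh hp ht hNp addpN.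
case=> [|[|[|[|[|[|//]]]]]] //= _; rewrite /mulp /= addp0 ?hh ?hp ?ht ?hNp //;
  exact: N0.
Qed.

End Orders.

(** * Classification of the halves of P *)

Section Halves.
Variables (K : fieldType) (E : ecurve K).
Implicit Types (a b c x y l : K) (p q h t : point E).

Lemma is_half_rot1 a b c h : is_half b c a h <-> is_half (- a) (- b) c h.
Proof. by rewrite /is_half; split=> ->; congr (Some (_, _)); ring. Qed.

Lemma is_half_rot2 a b c h : is_half c a b h <-> is_half (- a) b (- c) h.
Proof. by rewrite /is_half; split=> ->; congr (Some (_, _)); ring. Qed.

Lemma half_slope a b c h x y : square_roots E a b c -> is_half a b c h ->
  pval h = Some (x, y) ->
  (cubic E)^`().[x] = (a - b - c) * (2 * y) /\ y != 0.
Proof.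
move=> abc; have [[ab ab' bc] [bc' ca ca']] := square_roots_neq abc.
rewrite /is_half => -> [<- <-]; split; last by rewrite !mulf_neq0.
by rewrite (square_roots_deriv _ abc); ring.
Qed.

(** A point with nonzero ordinate has a single tangent slope; hence different values of a - b - c
    give different halves. *)
Lemma half_inj a b c a' b' c' h :
  square_roots E a b c -> square_roots E a' b' c' ->
  is_half a b c h -> is_half a' b' c' h -> a - b - c = a' - b' - c'.
Proof.
move=> r r' hh hh'; have [d y0] := half_slope r hh hh.
have [d' _] := half_slope r' hh' hh.
by apply: (mulIf (mulf_neq0 (two_neq0 E) y0)); rewrite -d -d'.
Qed.

(** The two equations say that 2h has abscissa 0 and that the tangent at h passes through (0, -abc);
    they recover x and y from the slope. *)
Lemma half_of_slope a b c h x y l : pval h = Some (x, y) -> l = a - b - c ->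
    l ^+ 2 = a ^+ 2 + b ^+ 2 + c ^+ 2 + 2 * x -> y = l * x - a * b * c ->
  is_half a b c h.
Proof.
move=> eh el ex ey; rewrite /is_half eh.
have ex' : x = b * c - a * b - c * a.
  apply: (mulfI (two_neq0 E)).
  by rewrite -(addKr (a ^+ 2 + b ^+ 2 + c ^+ 2) (2 * x)) -ex el; ring.
by rewrite ey el ex'; congr (Some (_, _)); ring.
Qed.

(** The even sign changes, which fix the product abc, in the order of [half1] to [half4]. *)
Definition one_of_halves a b c h :=
  [\/ is_half a b c h, is_half (- a) (- b) c h,
      is_half (- a) b (- c) h | is_half a (- b) (- c) h].

Lemma one_of_halves_signs a b c h : one_of_halves a b c h ->
  [/\ one_of_halves a (- b) (- c) h, one_of_halves (- a) b (- c) h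
    & one_of_halves (- a) (- b) c h].
Proof.
rewrite /one_of_halves !opprK.
by case=> ?; split;
  solve [exact: Or41 | exact: Or42 | exact: Or43 | exact: Or44].
Qed.

Lemma is_base_signs a b c p : is_base a b c p ->
  [/\ is_base a (- b) (- c) p, is_base (- a) b (- c) p
    & is_base (- a) (- b) c p].
Proof. by rewrite /is_base => ->; split; congr (Some (_, _)); ring. Qed.

Lemma one_of_halvesP a b c p q : square_roots E a b c -> is_base a b c p ->
  addp q q = p <-> one_of_halves a b c q.
Proof.
move=> abc ep; have [p4 p3 p2] := is_base_signs ep.
have [r4 r3 r2] := square_roots_signs abc.
split=> [|[] hq]; last 4 first.
- exact: addp_half_half abc hq ep.
- exact: addp_half_half r2 hq p2.
- exact: addp_half_half r3 hq p3.
- exact: addp_half_half r4 hq p4.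
have [s1 _] := square_roots_coef abc.
move=> /(congr1 val) /=; rewrite ep.
case eq: (pval q) => [[x y]|] //=; rewrite /slope !eqxx /= s1.
case: ifPn => // ny [hx hy].
have y20 : 2 * y != 0.
  by rewrite mulr_natl mulr2n addr_eq0.
pose l := (cubic E)^`().[x] / (2 * y).
rewrite -/l in hx hy; rewrite hx subr0 in hy.
have dl : (cubic E)^`().[x] = l * (2 * y) by rewrite /l divfK.
have hl : l ^+ 2 = a ^+ 2 + b ^+ 2 + c ^+ 2 + 2 * x.
  by apply/eqP; rewrite -subr_eq0 -hx; apply/eqP; ring.
have {}hy : y = l * x - a * b * c by rewrite -hy; ring.
have /eqP : (l - (a - b - c)) * (l - (- a - - b - c)) *
    (l - (- a - b - - c)) * (l - (a - - b - - c)) = 0.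
  (* Substituting y and l^2 turns the tangent relation into -x^2 + s2 + 2abc l = 0; as 2x = l^2 -
     s1, the factor -4 makes it a monic quartic in l. *)
  transitivity (- 4 * ((cubic E)^`().[x] - l * (2 * y))).
    by rewrite (square_roots_deriv _ abc) hy; ring: hl.
  by rewrite dl subrr mulr0.
have half u v w : l = u - v - w -> u ^+ 2 = a ^+ 2 -> v ^+ 2 = b ^+ 2 ->
    w ^+ 2 = c ^+ 2 -> u * v * w = a * b * c -> is_half u v w q.
  by move=> el ea eb ec em; apply: half_of_slope eq el _ _;
    rewrite ?ea ?eb ?ec ?em.
rewrite !mulf_eq0 !subr_eq0 => /orP[/orP[/orP[]|]|] /eqP el;
  [apply: Or41 | apply: Or42 | apply: Or43 | apply: Or44];
  by apply: half => //; rewrite ?sqrrN //; ring.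
Qed.

Lemma base_half a b c p : is_base a b c p -> b * c = a * b + c * a ->
  is_half a b c (oppp p).
Proof.
by rewrite /is_half => /= -> e; congr (Some (_, _)); ring: e.
Qed.

(** Each equality says that the abscissa of one half vanishes; by [base_half] its ordinate is then
    automatically -abc. *)
Lemma one_of_halves_oppP a b c p : is_base a b c p ->
  one_of_halves a b c (oppp p) <->
  [\/ b * c = a * b + c * a, c * a = a * b + b * c, a * b = b * c + c * a
    | a * b + b * c + c * a = 0].
Proof.
move=> ep; have [p4 p3 p2] := is_base_signs ep; split.
  rewrite /one_of_halves /is_half /= ep.
  case=> -[/esym e _]; [apply: Or41|apply: Or42|apply: Or43|apply: Or44];
    by apply/eqP; rewrite -subr_eq0; apply/eqP; rewrite -[RHS]e; ring.
case=> e; [apply: Or41|apply: Or42|apply: Or43|apply: Or44];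
  apply: base_half => //; rewrite ?mulrNN ?mulrN ?mulNr ?e; try by ring.
by apply/eqP; rewrite -subr_eq0 -[X in _ == X]e; apply/eqP; ring.
Qed.

End Halves.

(** * The addition table of the twelve points *)

Section SixByTwo.
Variables (K : fieldType) (E : ecurve K).

(** The hypotheses are stable under cyclic rotation, so three rotated instances of this row supply
    the table. *)
Lemma addition_row (a b c : K) (p h1 h2 h3 t1 t2 t3 : point E) :
    square_roots E a b c -> a * b = - (b * c + c * a) -> a * b * c != 0 ->
    is_base a b c p -> is_torsion a t1 -> is_torsion b t2 -> is_torsion c t3 ->
    is_half a b c h1 -> is_half b c a h2 -> is_half c a b h3 ->
  [/\ oppp t1 = t1, addp t1 t1 = zerop, addp t1 t2 = t3,
      addp p t1 = oppp h1 & addp h1 t1 = oppp p] /\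
  [/\ addp h1 t2 = h3, addp h1 t3 = h2, addp h1 p = t1,
      addp h1 (oppp p) = oppp h1 & addp h1 h1 = p] /\
  [/\ addp h1 h2 = oppp h3, addp h1 (oppp h2) = t3 & addp h1 (oppp h3) = t2].
Proof.
move=> abc e abc0 ep et1 et2 et3 eh1 eh2 eh3.
have /andP[/andP[_ b0] c0] : (a != 0) && (b != 0) && (c != 0).
  by move: abc0; rewrite !mulf_eq0 !negb_or.
have ot (q : point E) (x : K) : is_torsion x q -> oppp q = q.
  exact: torsion_opp.
have [r4 _ _] := square_roots_signs abc.
have cab := square_roots_rot (square_roots_rot abc).
have hNp : is_half a (- b) (- c) (oppp p).
  by apply: base_half; [have [] := is_base_signs ep | ring: e].
have ht1 := half_add_torsion1 abc eh1 et1 hNp.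
(* For the triple (a, -b, -c) the points h1 and -P exchange roles. *)
have Nht : addp (oppp p) t1 = h1.
  by apply: half_add_torsion1 r4 hNp et1 _; rewrite /is_half !opprK.
split; [|split]; split.
- exact: ot et1.
- by rewrite -{2}(ot _ _ et1) addpN.
- exact: torsion_add abc et1 et2 et3.
- by rewrite -[p]opppK -{1}(ot _ _ et1) -opppD Nht.
- exact: ht1.
- exact: half_add_torsion2 abc eh1 et2 eh3.
- exact: half_add_torsion3 abc eh1 et3 eh2.
- exact: half_add_base abc e abc0 eh1 ep et1.
- exact: half_sub_base abc e abc0 eh1 ep.
- exact: addp_half_half abc eh1 ep.
- exact: half_add_half abc e c0 eh1 eh2 eh3.
- exact: half_sub_half abc c0 eh1 eh2 et3.
- rewrite -(ot _ _ et2) -(half_sub_half cab b0 eh3 eh1 et2) opppD opppK.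
  exact: addpC.
Qed.


Lemma six_by_two (a b c : K) (p h1 h2 h3 t1 t2 t3 : point E) :
    square_roots E a b c -> a * b + b * c + c * a = 0 -> a * b * c != 0 ->
    is_base a b c p -> is_torsion a t1 -> is_torsion b t2 -> is_torsion c t3 ->
    is_half a b c h1 -> is_half b c a h2 -> is_half c a b h3 ->
  [/\ has_order h1 6, has_order h2 6, has_order h3 6
    & exists phi : 'Z_6 * 'Z_2 -> point E,
        injective phi
        /\ (forall u v : 'Z_6 * 'Z_2, phi (u + v) = addp (phi u) (phi v))].
Proof.
move=> r1 e abc0 ep et1 et2 et3 eh1 eh2 eh3.
have r2 := square_roots_rot r1; have r3 := square_roots_rot r2.
have e1 : a * b = - (b * c + c * a) by apply/eqP; rewrite -addr_eq0 addrA e.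
have e2 : b * c = - (c * a + a * b) by rewrite e1; ring.
have e3 : c * a = - (a * b + b * c) by rewrite e1; ring.
have abc2 : b * c * a != 0 by rewrite mulrC mulrA.
have abc3 : c * a * b != 0 by rewrite -mulrA mulrC.
have ep2 : is_base b c a p by rewrite /is_base ep; congr (Some (_, _)); ring.
have ep3 : is_base c a b p by rewrite /is_base ep; congr (Some (_, _)); ring.
have [[ot1 tt1 tt12 pt1 ht11] [[ht12 ht13 hp1 hNp1 hh1] [hh12 hNh12 hNh13]]] :=
  addition_row r1 e1 abc0 ep et1 et2 et3 eh1 eh2 eh3.
have [[ot2 tt2 tt23 pt2 ht22] [[ht23 ht21 hp2 hNp2 hh2] [hh23 hNh23 hNh21]]] :=
  addition_row r2 e2 abc2 ep2 et2 et3 et1 eh2 eh3 eh1.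
have [[ot3 tt3 tt31 pt3 ht33] [[ht31 ht32 hp3 hNp3 hh3] [hh31 hNh31 hNh32]]] :=
  addition_row r3 e3 abc3 ep3 et3 et1 et2 eh3 eh1 eh2.
(* As -P is the fourth half, 2(-P) = P; negate both sides. *)
have pp : addp p p = oppp p.
  rewrite -{3}(one_of_halvesP (oppp p) r1 ep).2 ?opppD ?opppK //.
  by apply/(one_of_halves_oppP ep); apply: Or44.
have T := (ot1, ot2, ot3, oppp0 E).
have B := ((tt1, tt12, pt1, ht11, ht12, ht13, hp1, hNp1, hh1, hh12),
  (hNh12, hNh13, tt2, tt23, pt2, ht22, ht23, ht21, hp2, hNp2, hh2),
  (hh23, hNh23, hNh21, tt3, tt31, pt3, ht33, ht31, ht32, hp3, hNp3, hh3),
  (hh31, hNh31, hNh32, pp, @add0p _ E, @addp0 _ E, @addpN _ E)).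
have nz (q : point E) (x y : K) : pval q = Some (x, y) -> q <> zerop.
  by move=> eq q0; rewrite q0 in eq.
have p0 := nz _ _ _ ep.
split.
- exact: has_order6 (nz _ _ _ eh1) p0 (nz _ _ _ et1) hh1 hp1 ht11 hNp1.
- exact: has_order6 (nz _ _ _ eh2) p0 (nz _ _ _ et2) hh2 hp2 ht22 hNp2.
- exact: has_order6 (nz _ _ _ eh3) p0 (nz _ _ _ et3) hh3 hp3 ht33 hNp3.
(* h1 = - p + t1 has order 6, and its translates by t2 form the second row. *)
pose pts := [:: [:: zerop; h1; p; t1; oppp p; oppp h1];
                [:: t2; h3; oppp h2; t3; h2; oppp h3]].
pose phi (u : 'Z_6 * 'Z_2) := nth zerop (nth [::] pts u.2) u.1.
(* Each of the 144 sums is in [B] up to swapping the summands, negating both sides, or both. *)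
have phiD u v : phi (u + v) = addp (phi u) (phi v).
  case: u v => [[u hu] [v hv]] [[x hx] [y hy]]; rewrite /phi /=.
  move: hu hv hx hy.
  case: u => [|[|[|[|[|[|//]]]]]] _; (case: v => [|[|//]] _);
  (case: x => [|[|[|[|[|[|//]]]]]] _); (case: y => [|[|//]] _) => /=;
  first [ by rewrite B | by rewrite addpC B
        | by rewrite -[RHS]opppK opppD ?opppK ?T B ?opppK ?T
        | by rewrite -[RHS]opppK opppD ?opppK ?T addpC B ?opppK ?T ].
have phi0 u : phi u = zerop -> u = 0.
  case: u => [[u hu] [v hv]]; rewrite /phi /=; move: hu hv.
  case: u => [|[|[|[|[|[|//]]]]]] hu; (case: v => [|[|//]] hv) => /(congr1 val);
  rewrite /= ?ep ?et1 ?et2 ?et3 ?eh1 ?eh2 ?eh3 //.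
  by move=> _; congr pair; apply: val_inj.
(* An additive map with trivial kernel is injective: phi (u - v) = phi v + phi (-v) = phi 0. *)
exists phi; split=> // u v uv; apply/eqP; rewrite -subr_eq0; apply/eqP/phi0.
by rewrite phiD uv -phiD subrr.
Qed.


Lemma exists_torsion (a b c : K) : square_roots E a b c ->
  exists t : point E, is_torsion a t.
Proof.
case=> e _; have et : 0 ^+ 2 = (cubic E).[- a ^+ 2].
  by rewrite e horner_squares_cubic; ring.
by exists (affine_point et).
Qed.

Lemma exists_half (a b c : K) : square_roots E a b c ->
  exists h : point E, is_half a b c h.
Proof.
case=> e _; have eh : ((a - b) * (b + c) * (c - a)) ^+ 2 =
    (cubic E).[b * c - a * b - c * a].
  by rewrite e horner_squares_cubic; ring.
by exists (affine_point eh).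
Qed.

Lemma order3_structure (a b c : K) (p : point E) :
    square_roots E a b c -> is_base a b c p -> a * b * c != 0 ->
    one_of_halves a b c (oppp p) ->
  (forall q : point E, one_of_halves a b c q -> q <> oppp p -> has_order q 6) /\
  exists phi : 'Z_6 * 'Z_2 -> point E,
    injective phi
    /\ (forall u v : 'Z_6 * 'Z_2, phi (u + v) = addp (phi u) (phi v)).
Proof.
move=> abc ep abc0 hNp.
(* An even sign change makes -P the fourth half, so that its zero abscissa reads ab + bc + ca =
   0. *)
wlog {hNp} hNp : a b c abc ep abc0 / is_half a (- b) (- c) (oppp p).
  have [r4 r3 r2] := square_roots_signs abc.
  have [p4 p3 p2] := is_base_signs ep.
  move=> wl; case: (hNp) => hN.
  - have [||||h phi] := wl a (- b) (- c);
      rewrite ?opprK ?mulrNN ?mulrN ?mulNr ?opprK //.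
    by split=> // q /one_of_halves_signs[] /h.
  - have [||||h phi] := wl (- a) b (- c);
      rewrite ?opprK ?mulrNN ?mulrN ?mulNr ?opprK //.
    by split=> // q /one_of_halves_signs[_] /h.
  - have [||||h phi] := wl (- a) (- b) c;
      rewrite ?opprK ?mulrNN ?mulrN ?mulNr ?opprK //.
    by split=> // q /one_of_halves_signs[_ _] /h.
  exact: (wl a b c).
have e : a * b + b * c + c * a = 0.
  move: hNp; rewrite /is_half /= ep => -[/esym e _].
  by rewrite -[RHS]e; ring.
have cab := square_roots_rot (square_roots_rot abc).
have bca := square_roots_rot abc.
have [t1 et1] := exists_torsion abc.
have [t2 et2] := exists_torsion bca.
have [t3 et3] := exists_torsion cab.
have [h1 eh1] := exists_half abc.
have [h2 eh2] := exists_half bca.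
have [h3 eh3] := exists_half cab.
(* The halves stay variable so that a given q can take the place of any one of them. *)
have S q1 q2 q3 :=
  @six_by_two a b c p q1 q2 q3 t1 t2 t3 abc e abc0 ep et1 et2 et3.
split; last by have [] := S _ _ _ eh1 eh2 eh3.
move=> q [] hq nq.
- by have [] := S _ _ _ hq eh2 eh3.
- by have [] := S _ _ _ eh1 ((is_half_rot1 a b c q).2 hq) eh3.
- by have [] := S _ _ _ eh1 eh2 ((is_half_rot2 a b c q).2 hq).
- by case: nq; apply: val_inj; exact: etrans hq (esym hNp).
Qed.

End SixByTwo.

(** * Assembly of the claims for the given curve and points *)

Theorem theorem7p2 (K : fieldType) (charK : 2%N \notin [pchar K])
    (a1 a2 a3 : K) (sqrU : uniq [:: a1 ^+ 2; a2 ^+ 2; a3 ^+ 2]) :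
  let E : ecurve K := squares_curve charK sqrU in
  let P : point E := base_point charK sqrU in
  let Qs : seq (point E) := halves charK sqrU in
  [/\ [/\ exists Q : point E, mulp 2 Q = P,
          uniq Qs
        & forall Q : point E, mulp 2 Q = P <-> Q \in Qs],
      (a1 != 0 -> a2 != 0 -> a3 != 0 ->
         uniq [:: a1; - a1; a2; - a2; a3; - a3])
      /\ (has_order P 3 <->
          [/\ a1 != 0, a2 != 0, a3 != 0
            & [\/ a2 * a3 = a1 * a2 + a3 * a1,
                  a3 * a1 = a1 * a2 + a2 * a3,
                  a1 * a2 = a2 * a3 + a3 * a1
                | a1 * a2 + a2 * a3 + a3 * a1 = 0]])
    & has_order P 3 ->
      (exists2 Q0 : point E, Q0 \in Qs &
         [/\ Q0 = oppp P, has_order Q0 3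
           & forall Q : point E, Q \in Qs -> Q != Q0 -> has_order Q 6])
      /\ (exists phi : 'Z_6 * 'Z_2 -> point E,
            injective phi
            /\ (forall u v : 'Z_6 * 'Z_2, phi (u + v) = addp (phi u) (phi v)))].
Proof.
move=> E P Qs.
have r1 : square_roots E a1 a2 a3 by split.
have [r4 r3 r2] := square_roots_signs r1.
have [[d12 s12 d23] [s23 d31 s31]] := square_roots_neq r1.
have eP : is_base a1 a2 a3 P by [].
have e1 : is_half a1 a2 a3 (half1 charK sqrU) by [].
have e2 : is_half (- a1) (- a2) a3 (half2 charK sqrU).
  by congr (Some (_, _)); ring.
have e3 : is_half (- a1) a2 (- a3) (half3 charK sqrU).
  by congr (Some (_, _)); ring.
have e4 : is_half a1 (- a2) (- a3) (half4 charK sqrU).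
  by congr (Some (_, _)); ring.
have QsP Q : Q \in Qs <-> one_of_halves a1 a2 a3 Q.
  rewrite !inE; split=> [/or4P[]/eqP ->|].
  - exact: Or41.
  - exact: Or42.
  - exact: Or43.
  - exact: Or44.
  by case=> hQ; apply/or4P;
    [apply: Or41 | apply: Or42 | apply: Or43 | apply: Or44];
    apply/eqP/val_inj; [ exact: etrans hQ (esym e1) | exact: etrans hQ (esym e2)
      | exact: etrans hQ (esym e3) | exact: etrans hQ (esym e4)].
have two0 := two_neq0 E.
have halfP Q : mulp 2 Q = P <-> Q \in Qs.
  by rewrite mulp2; apply: (iff_trans (one_of_halvesP Q r1 eP)); apply: iff_sym.
have ordP : has_order P 3 <->
    [/\ a1 != 0, a2 != 0, a3 != 0 & one_of_halves a1 a2 a3 (oppp P)].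
  split=> [/has_order3P[nP PP]|[n1 n2 n3 hN]].
    (* Otherwise P = -P, so 2P = O, whereas 2P = -P is affine. *)
    have n0 : a1 * a2 * a3 != 0.
      apply/eqP => z.
      have oP : oppp P = P by apply: val_inj; rewrite /= z oppr0.
      by have := addpN P; rewrite oP PP => /(congr1 val).
    move: n0; rewrite !mulf_eq0 !negb_or => /andP[/andP[-> ->] ->]; split=> //.
    by apply/(one_of_halvesP _ r1 eP); rewrite -opppD PP opppK.
  apply/has_order3P; split=> //.
  by rewrite -[LHS]opppK opppD ((one_of_halvesP _ r1 eP).2 hN).
split.
- split=> //; first by exists (half1 charK sqrU); apply/halfP; rewrite inE eqxx.
  (* Tangent slopes of two halves differ by twice a nonzero factor s, up to a sign absorbed by
     squaring. *)
  have neq u v w u' v' w' (q q' : point E) (s : K) :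
      square_roots E u v w -> is_half u v w q ->
      square_roots E u' v' w' -> is_half u' v' w' q' -> s != 0 ->
      (u - v - w - (u' - v' - w')) ^+ 2 = (2 * s) ^+ 2 -> q != q'.
    move=> r hq r' hq' s0 e; apply: contraNneq (mulf_neq0 two0 s0) => qq'.
    rewrite -qq' in hq'.
    by rewrite -sqrf_eq0 -e (half_inj r r' hq hq') subrr expr0n.
  rewrite /= !inE !negb_or !andbT; apply/and3P; split;
    [apply/and3P; split|apply/andP; split|].
  - by apply: neq r1 e1 r2 e2 d12 _; ring.
  - by apply: neq r1 e1 r3 e3 d31 _; ring.
  - by apply: neq r1 e1 r4 e4 s23 _; ring.
  - by apply: neq r2 e2 r3 e3 d23 _; ring.
  - by apply: neq r2 e2 r4 e4 s31 _; ring.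
  - by apply: neq r3 e3 r4 e4 s12 _; ring.
- split.
    move=> n1 n2 n3; rewrite /= !inE !eqr_opp !eqr_oppLR -!addr_eq0.
    have dbl (x : K) : x != 0 -> x + x != 0.
      by move=> x0; rewrite -mulr2n -mulr_natl mulf_neq0.
    rewrite (eq_sym a1 a3) (addrC a1 a3).
    rewrite !subr_eq0 in d12 d23 d31.
    rewrite (negbTE d12) (negbTE d23) (negbTE d31).
    by rewrite (negbTE s12) (negbTE s23) (negbTE s31) !negb_or !dbl.
  apply: (iff_trans ordP); split=> -[n1 n2 n3 h]; split=> //.
    exact/(one_of_halves_oppP eP).
  exact/(one_of_halves_oppP eP).
move=> P3; have /ordP[n1 n2 n3 hN] := P3.
have [o6 phi] := order3_structure r1 eP (mulf_neq0 (mulf_neq0 n1 n2) n3) hN.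
split=> //; exists (oppp P); first exact/QsP.
split=> //; last by move=> Q /QsP hQ /eqP; apply: o6.
have /has_order3P[nP PP] := P3.
apply/has_order3P; split; last by rewrite -opppD PP.
by move=> z; apply: nP; rewrite -[P]opppK z oppp0.
Qed.
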